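(* Let $\overrightarrow{G}=(V,E)$ be a strongly connected digraph on $n$ vertices with vertex set $V=\{v_1,\ldots,v_n\}$, and let $d_{ij}=d_{\overrightarrow{G}}(v_i,v_j)$ denote the distance from $v_i$ to $v_j$. Then $$\rho^{\mathcal{D}}(\overrightarrow{G})\leq \max_{1\leq i\leq n}\sqrt{(n-1)\sum_{k=1}^n d_{ki}^2}.$$ If equality holds, then $\sum_{k=1}^n d_{ki}^2=\sum_{k=1}^n d_{kj}^2$ for any $i,j\in\{1,2,\ldots,n\}$.
   Context: Digraphs are finite and simple (no loops, no multiple arcs). A digraph is strongly connected if for every pair of vertices $v_i,v_j$ there are directed paths from $v_i$ to $v_j$ and from $v_j$ to $v_i$. The distance $d_{\overrightarrow{G}}(u,v)$ is the length of a shortest directed path from $u$ to $v$. The distance matrix is the $n\times n$ matrix $\mathcal{D}(\overrightarrow{G})=(d_{ij})$ with $d_{ij}=d_{\overrightarrow{G}}(v_i,v_j)$. The distance spectral radius $\rho^{\mathcal{D}}(\overrightarrow{G})$ is the spectral radius (largest modulus of an eigenvalue) of $\mathcal{D}(\overrightarrow{G})$. *)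

(* Defs.v *)
From HB Require Import structures.
From mathcomp Require Import all_boot all_order all_algebra.
From mathcomp Require Import complex.
From mathcomp Require Import classical_sets reals.

Set Implicit Arguments.
Unset Strict Implicit.
Unset Printing Implicit Defensive.

Import Order.TTheory GRing.Theory Num.Theory.

Local Open Scope ring_scope.

Section Digraph.
Variables (T : finType) (e : rel T).

(* A simple digraph on T is an irreflexive relation e, with e u v meaning that
   there is an arc from u to v.  A path from u to v visits the vertices u :: p,
   so that its length is size p. *)
Definition directed_path (u v : T) (p : seq T) : bool :=
  [&& path e u p, last u p == v & uniq (u :: p)].

Definition strongly_connected : Prop :=
  forall u v : T, exists p : seq T, directed_path u v p.

(* The search stops below #|T| because a directed path repeats no vertex; the
   value is #|T| when no path exists. *)
Definition dist (u v : T) : nat :=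
  find (fun k => [exists p : k.-tuple T, directed_path u v p]) (iota 0 #|T|).

Lemma dist_le (u v : T) (p : seq T) :
  directed_path u v p -> (dist u v <= size p)%N.
Proof.
move=> hp; have lt_p : (size p < #|T|)%N.
  have /and3P[_ _ up] := hp.
  by have := max_card (mem (u :: p)); rewrite (card_uniqP up).
rewrite leqNgt; apply/negP=> /(before_find 0%N); rewrite nth_iota// add0n.
by move/existsP; apply; exists (in_tuple p).
Qed.

Lemma dist_attained (u v : T) : strongly_connected ->
  exists2 p : seq T, directed_path u v p & size p = dist u v.
Proof.
move=> /(_ u v)[p hp]; have lt_d : (dist u v < #|T|)%N.
  apply: leq_ltn_trans (dist_le hp) _; have /and3P[_ _ up] := hp.
  by have := max_card (mem (u :: p)); rewrite (card_uniqP up).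
have: has (fun k => [exists p : k.-tuple T, directed_path u v p])
          (iota 0 #|T|) by rewrite has_find size_iota.
move/(nth_find 0%N); rewrite -/(dist u v) nth_iota// add0n.
by case/existsP=> q hq; exists q; rewrite ?size_tuple.
Qed.

End Digraph.

Definition distance_matrix (R : realType) (n : nat) (e : rel 'I_n) : 'M[R]_n :=
  \matrix_(i, j) (dist e i j)%:R.

(* For n > 0 the set of moduli is finite and nonempty, hence its supremum is the
   largest modulus of a complex eigenvalue. *)
Definition spectral_radius (R : realType) (n : nat) (A : 'M[R]_n) : R :=
  sup [set r : R | exists2 z : R[i],
         eigenvalue (map_mx (real_complex R) A) z
         & r = ComplexField.Normc.normc z]%classic.

Definition distance_spectral_radius (R : realType) (n : nat) (e : rel 'I_n) : R :=
  spectral_radius (distance_matrix R e).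

(* Main.v *)
Require Import Defs.
From HB Require Import structures.
From mathcomp Require Import all_boot all_order all_algebra.
From mathcomp Require Import complex.
From mathcomp Require Import classical_sets reals.
From mathcomp Require Import ring.

Set Implicit Arguments.
Unset Strict Implicit.
Unset Printing Implicit Defensive.

Import Order.TTheory GRing.Theory Num.Theory.

Local Open Scope ring_scope.

(** The bound holds for every nonnegative matrix A with zero diagonal.  Let S_j
    be the sum of the squares of its j-th column, and z an eigenvalue with left
    eigenvector v, so that z v_j = sum_k v_k A_kj.  Since A_jj = 0, the entry
    v_j does not occur on the right, and the Cauchy-Schwarz inequality gives,
    with W = sum_k |v_k|^2,
      |z|^2 |v_j|^2 <= (W - |v_j|^2) S_j.
    The weights W - |v_j|^2 add up to (n - 1) W; so summing over j bounds
    |z|^2 by (n - 1) max_j S_j ([column_bound]).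

    If this bound is attained, then S_j is maximal wherever the weight
    W - |v_j|^2 is nonzero.  A zero weight means that v is supported on j
    alone; then z v_j = 0, so z = 0, and the bound itself is 0, which again
    makes all (n - 1) S_j equal.  For n > 1 the S_j are then equal themselves.

    Both conclusions transfer to the spectral radius because it is itself the
    modulus of an eigenvalue ([spectral_radius_attained]). *)

Lemma sum_cauchy_schwarz (R : realDomainType) (I : finType) (P : pred I)
    (f g : I -> R) :
  (\sum_(i | P i) f i * g i) ^+ 2
    <= (\sum_(i | P i) f i ^+ 2) * (\sum_(i | P i) g i ^+ 2).
Proof.
set c := \sum_(i | P i) f i * g i; set a := \sum_(i | P i) f i ^+ 2.
set b := \sum_(i | P i) g i ^+ 2.
have b_ge0 : 0 <= b by apply: sumr_ge0 => i _; exact: sqr_ge0.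
have [b0|b_neq0] := eqVneq b 0.
  have c0 : c = 0.
    apply: big1 => i Pi.
    have /eqP := psumr_eq0P (fun i _ => sqr_ge0 (g i)) b0 Pi.
    by rewrite sqrf_eq0 => /eqP->; rewrite mulr0.
  by rewrite c0 b0 mulr0 expr0n.
have : 0 <= \sum_(i | P i) (b * f i - c * g i) ^+ 2.
  by apply: sumr_ge0 => i _; exact: sqr_ge0.
(* The residual f - (c / b) g of projecting f onto g, cleared of denominators,
   has squared norm b (a b - c^2). *)
have -> : \sum_(i | P i) (b * f i - c * g i) ^+ 2 = b * (a * b - c ^+ 2).
  transitivity (\sum_(i | P i) (b ^+ 2 * f i ^+ 2
    + (- 2 * b * c) * (f i * g i) + c ^+ 2 * g i ^+ 2)).
    by apply: eq_bigr => i _; ring.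
  by rewrite !big_split /= -!mulr_sumr -/a -/b -/c; ring.
by rewrite pmulr_rge0 ?subr_ge0// lt_def b_neq0.
Qed.

(** When w is supported on j alone, the inequality at j reads
    r w_j <= w_j A_jj = 0. *)
Lemma hollow_concentrated (R : realFieldType) (n : nat) (A : 'M[R]_n)
    (w : 'I_n -> R) (r : R) (j : 'I_n) :
    A j j = 0 -> 0 <= r -> 0 < w j ->
    r * w j <= \sum_k w k * A k j ->
    (forall k, k != j -> w k = 0) ->
  r = 0.
Proof.
move=> Ajj r_ge0 wj_gt0 sub w0; apply/le_anti; rewrite r_ge0 andbT.
rewrite -(pmulr_lle0 _ wj_gt0); apply: le_trans sub _.
rewrite (bigD1 j)//= Ajj mulr0 add0r big1// => k /w0->.
by rewrite mul0r.
Qed.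

(** The vector w stands for the entrywise modulus of an eigenvector, and r for
    the modulus of its eigenvalue.  The factor n - 1 is kept in the conclusion
    because for n = 1 it vanishes and r ^+ 2 = B = 0 tells nothing about S_j
    itself. *)
Lemma column_bound (R : realFieldType) (n : nat) (A : 'M[R]_n)
    (w : 'I_n -> R) (r B : R) :
    (forall i, A i i = 0) -> 0 <= r -> (forall k, 0 <= w k) ->
    0 < \sum_k w k ^+ 2 ->
    (forall j, r * w j <= \sum_k w k * A k j) -> 0 <= B ->
    (forall j, (n%:R - 1) * \sum_k A k j ^+ 2 <= B) ->
  r ^+ 2 <= B /\
  (r ^+ 2 = B -> forall j, (n%:R - 1) * \sum_k A k j ^+ 2 = B).
Proof.
move=> A0 r_ge0 w_ge0; set W := \sum_k w k ^+ 2 => W_gt0 sub B_ge0.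
pose S j := \sum_k A k j ^+ 2.
change ((forall j, (n%:R - 1) * S j <= B) ->
  r ^+ 2 <= B /\ (r ^+ 2 = B -> forall j, (n%:R - 1) * S j = B)) => SB.
have S_ge0 j : 0 <= S j by apply: sumr_ge0 => k _; exact: sqr_ge0.
have n_gt0 : (0 < n)%N.
  rewrite lt0n; apply: contraTneq W_gt0 => n0; subst n.
  by rewrite /W big_ord0 ltxx.
have n1_ge0 : 0 <= n%:R - 1 :> R by rewrite subr_ge0 ler1n.
have W_off j : W - w j ^+ 2 = \sum_(k | k != j) w k ^+ 2.
  by rewrite /W (bigD1 j)//= addrAC subrr add0r.
have weight_ge0 j : 0 <= W - w j ^+ 2.
  by rewrite W_off; apply: sumr_ge0 => k _; exact: sqr_ge0.
have [->|r_neq0] := eqVneq r 0.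
  rewrite expr0n /=; split=> // B0 j; apply/le_anti; rewrite SB -B0.
  by rewrite mulr_ge0.
have weight_gt0 j : 0 < W - w j ^+ 2.
  rewrite lt_def weight_ge0 andbT; apply: contra_neq r_neq0 => weight0.
  have w0 k : k != j -> w k = 0.
    move=> kj; apply/eqP; rewrite -sqrf_eq0; apply/eqP.
    have off0 : \sum_(k | k != j) w k ^+ 2 = 0 by rewrite -W_off.
    exact: (psumr_eq0P (fun k _ => sqr_ge0 (w k)) off0 kj).
  apply: (hollow_concentrated (A0 j) r_ge0 _ (sub j) w0).
  rewrite lt_def w_ge0 andbT -sqrf_eq0; apply: contraTneq W_gt0 => wj0.
  by rewrite -[W](subrK (w j ^+ 2)) weight0 wj0 addr0 ltxx.
have entry j : r ^+ 2 * w j ^+ 2 <= (W - w j ^+ 2) * S j.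
  have off_diag : \sum_k w k * A k j = \sum_(k | k != j) w k * A k j.
    by rewrite (bigD1 j)//= A0 mulr0 add0r.
  have -> : S j = \sum_(k | k != j) A k j ^+ 2.
    by rewrite /S (bigD1 j)//= A0 expr0n add0r.
  rewrite W_off -exprMn; apply: le_trans (sum_cauchy_schwarz _ _ _).
  have lhs_ge0 : 0 <= r * w j by exact: mulr_ge0.
  by rewrite -off_diag ler_sqr ?nnegrE// (le_trans lhs_ge0 (sub j)).
have weights : \sum_j (W - w j ^+ 2) = (n%:R - 1) * W.
  by rewrite sumrB sumr_const card_ord -/W mulrBl mul1r mulr_natl.
have n1_gt0 : 0 < n%:R - 1 :> R.
  rewrite -(pmulr_lgt0 _ W_gt0) -weights (bigD1 (Ordinal n_gt0))//=.
  by rewrite ltr_pwDl// sumr_ge0.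
(* Both the bound and the equality case come from this sum: its terms are
   nonnegative, and its total is at most a positive multiple of B - r^2. *)
have defect_ge0 j : 0 <= (W - w j ^+ 2) * (B - (n%:R - 1) * S j).
  by rewrite mulr_ge0// subr_ge0.
have defect_le : \sum_j (W - w j ^+ 2) * (B - (n%:R - 1) * S j)
    <= (n%:R - 1) * W * (B - r ^+ 2).
  have -> : (n%:R - 1) * W * (B - r ^+ 2)
      = (\sum_j (W - w j ^+ 2)) * B - (n%:R - 1) * \sum_j r ^+ 2 * w j ^+ 2.
    by rewrite weights -mulr_sumr -/W; ring.
  rewrite mulr_suml mulr_sumr -sumrB; apply: ler_sum => j _.
  rewrite mulrBr lerD2l lerN2 [leRHS]mulrCA ler_pM2l//; exact: entry.
have scale_gt0 : 0 < (n%:R - 1) * W by rewrite mulr_gt0.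
split.
  rewrite -subr_ge0 -(pmulr_rge0 _ scale_gt0).
  exact: le_trans (sumr_ge0 _ (fun j _ => defect_ge0 j)) defect_le.
move=> r2B j; move: defect_le; rewrite r2B subrr mulr0 => defect_le0.
have defect0 : \sum_j (W - w j ^+ 2) * (B - (n%:R - 1) * S j) = 0.
  by apply/le_anti; rewrite defect_le0 sumr_ge0.
have /eqP : (W - w j ^+ 2) * (B - (n%:R - 1) * S j) = 0.
  exact: (psumr_eq0P (fun j _ => defect_ge0 j) defect0).
by rewrite mulf_eq0 gt_eqF//= subr_eq0 => /eqP->.
Qed.

Import ComplexField.Normc.

Lemma normc_ge0 (R : rcfType) (z : R[i]) : 0 <= normc z.
Proof. by case: z => a b; exact: sqrtr_ge0. Qed.

Lemma normc_real (R : rcfType) (x : R) : 0 <= x -> normc (real_complex R x) = x.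
Proof. by move=> x_ge0; rewrite /= expr0n addr0 sqrtr_sqr ger0_norm. Qed.

Lemma le_normc_sum (R : rcfType) (I : finType) (f : I -> R[i]) :
  normc (\sum_i f i) <= \sum_i normc (f i).
Proof.
elim/big_rec2: _ => [|i x y _ le_yx]; first by rewrite normc0.
by apply: le_trans (le_normcD _ _) _; rewrite lerD2l.
Qed.

(** The row vector v satisfies v A = z v; taking moduli entrywise leaves an
    inequality between real numbers. *)
Lemma eigenvector_modulus (R : rcfType) (n : nat) (A : 'M[R]_n) (z : R[i]) :
    (forall i j, 0 <= A i j) ->
    eigenvalue (map_mx (real_complex R) A) z ->
  exists w : 'I_n -> R,
    [/\ forall k, 0 <= w k, 0 < \sum_k w k ^+ 2
      & forall j, normc z * w j <= \sum_k w k * A k j].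
Proof.
move=> A_ge0 /eigenvalueP[v vA v_neq0]; exists (fun k => normc (v 0 k)); split.
- by move=> k; exact: normc_ge0.
- rewrite lt_def sumr_ge0 ?andbT; last by move=> k _; exact: sqr_ge0.
  apply: contra_neq v_neq0 => sum0; apply/rowP => k; rewrite mxE.
  apply: eq0_normc; apply/eqP; rewrite -sqrf_eq0; apply/eqP.
  exact: (psumr_eq0P (fun k _ => sqr_ge0 (normc (v 0 k))) sum0).
- move=> j; have := congr1 (fun u : 'rV_n => normc (u 0 j)) vA.
  rewrite !mxE normcM => <-; apply: le_trans (le_normc_sum _) _.
  by apply: ler_sum => k _; rewrite mxE normcM normc_real.
Qed.

Lemma sup_seq_mem (R : realType) (s : seq R) :
  s != [::] -> sup [set` s]%classic \in s.
Proof.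
case: s => // x s _.
have [y ys y_max] : exists2 y, y \in x :: s & forall t, t \in x :: s -> t <= y.
  elim: s x => [|x' s IHs] x.
    by exists x; rewrite ?mem_head// => t; rewrite inE => /eqP->.
  have [y ys y_max] := IHs x'; have [xy|/ltW yx] := leP x y.
    exists y => [|t]; first by rewrite inE ys orbT.
    by rewrite inE => /predU1P[->//|]; exact: y_max.
  exists x => [|t]; first exact: mem_head.
  by rewrite inE => /predU1P[->//|/y_max/le_trans]; exact.
suff -> : sup [set` x :: s]%classic = y by [].
apply/le_anti/andP; split.
  by apply: ge_sup => [|t /y_max//]; exists y.
by apply: ub_le_sup => //; exists y => t /y_max.
Qed.

(** Over the algebraically closed field R[i] the eigenvalues are the finitely
    many roots of the characteristic polynomial, and there is at least one. *)
Lemma spectral_radius_attained (R : realType) (n : nat) (A : 'M[R]_n) :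
    (0 < n)%N ->
  exists2 z : R[i], eigenvalue (map_mx (real_complex R) A) z
    & spectral_radius A = normc z.
Proof.
move=> n_gt0; set M := map_mx _ A.
have [s char_roots] := closed_field_poly_normal (char_poly M).
rewrite (monicP (char_poly_monic M)) scale1r in char_roots.
have eigen z : eigenvalue M z = (z \in s).
  by rewrite eigenvalue_root_char char_roots root_prod_XsubC.
have s_neq0 : map (@normc R) s != [::].
  have := size_char_poly M; rewrite char_roots size_prod_XsubC => -[size_s].
  by rewrite -size_eq0 size_map size_s -lt0n.
have -> : spectral_radius A = sup [set` map (@normc R) s]%classic.
  congr sup; apply/seteqP; split=> r /=.
    by move=> [z]; rewrite eigen => zs ->; exact: map_f.
  by move=> /mapP[z zs ->]; exists z; rewrite ?eigen.
by have /mapP[z zs ->] := sup_seq_mem s_neq0; exists z; rewrite ?eigen.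
Qed.

Lemma dist_diag (T : finType) (e : rel T) (u : T) : dist e u u = 0%N.
Proof.
apply/eqP; rewrite -leqn0.
by apply: (@dist_le _ _ _ _ [::]); rewrite /directed_path /= eqxx.
Qed.

Theorem theorem4p3 (R : realType) (n : nat) (e : rel 'I_n)
    (n_gt0 : (0 < n)%N) (e_irr : irreflexive e)
    (e_strong : strongly_connected e) :
  let bound : R :=
    \big[Num.max/0]_(i < n)
      Num.sqrt ((n%:R - 1) * \sum_(k < n) (dist e k i)%:R ^+ 2) in
  distance_spectral_radius R e <= bound /\
  (distance_spectral_radius R e = bound ->
   forall i j : 'I_n,
     \sum_(k < n) (dist e k i)%:R ^+ 2 = \sum_(k < n) (dist e k j)%:R ^+ 2 :> R).
Proof.
move=> bound; rewrite /distance_spectral_radius.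
set A := distance_matrix R e.
have [z z_eig ->] := spectral_radius_attained A n_gt0.
have A_ge0 i j : 0 <= A i j by rewrite mxE ler0n.
have [w [w_ge0 w_neq0 w_sub]] := eigenvector_modulus A_ge0 z_eig.
have A_diag i : A i i = 0 by rewrite mxE dist_diag.
have A_col j : \sum_k A k j ^+ 2 = \sum_(k < n) (dist e k j)%:R ^+ 2.
  by apply: eq_bigr => k _; rewrite mxE.
have n1_ge0 : 0 <= n%:R - 1 :> R by rewrite subr_ge0 ler1n.
have bound_ge0 : 0 <= bound by exact: bigmax_ge_id.
have col_le j : (n%:R - 1) * \sum_k A k j ^+ 2 <= bound ^+ 2.
  have col_ge0 : 0 <= (n%:R - 1) * \sum_k A k j ^+ 2.
    by rewrite mulr_ge0// sumr_ge0// => k _; exact: sqr_ge0.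
  rewrite -(sqr_sqrtr col_ge0) ler_sqr ?nnegrE ?sqrtr_ge0// A_col.
  exact: (le_bigmax 0 (fun i => Num.sqrt (_ * \sum_(k < n) (dist e k i)%:R ^+ 2))).
have [le_bound eq_bound] := column_bound A_diag (normc_ge0 z) w_ge0 w_neq0
  w_sub (sqr_ge0 bound) col_le.
split; first by rewrite -ler_sqr ?nnegrE ?normc_ge0.
move=> z_bound i j; have [-> //|ij] := eqVneq i j.
have n1_neq0 : n%:R - 1 != 0 :> R.
  rewrite subr_eq0 pnatr_eq1; apply: contra_neq ij => n1.
  by subst n; rewrite !ord1.
have col := eq_bound (congr1 (fun x => x ^+ 2) z_bound).
by apply: (mulfI n1_neq0); rewrite -!A_col !col.
Qed.
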